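(* Fix $\epsilon,\delta\in(0,1)$ and $\mathbf{U}\in\mathbb{R}^{N\times d}$ with orthonormal columns. Let $\tilde\delta=\delta/2$ and $\tilde\epsilon=\sqrt{1+\epsilon}-1$. Let $\mathbf{\Pi}_1\in\mathbb{R}^{R\times N}$ and $\mathbf{\Pi}_2\in\mathbb{R}^{\tilde R\times R}$ be sketching matrices (random matrices) which both satisfy the $\ell_2$-subspace embedding property with error probability $\tilde\delta$ and distortion $\tilde\epsilon$, for $\mathrm{im}(\mathbf{U})$ and $\mathrm{im}(\mathbf{\Pi}_1\mathbf{U})$ respectively. Then the hybrid sketching matrix $\hat{\mathbf{S}}=\mathbf{\Pi}_2\mathbf{\Pi}_1$ satisfies the $\ell_2$-subspace embedding property for $\mathrm{im}(\mathbf{U})$ with error probability $\delta$ and distortion $\epsilon$.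
   Context: Definition ($\ell_2$-subspace embedding property with error probability $\delta$ and distortion $\epsilon$): a (random) matrix $\mathbf{S}$ with $m$ columns has this property for a subspace $T\subseteq\mathbb{R}^m$ if, for a matrix $\mathbf{Q}$ whose columns form an orthonormal basis of $T$, $\|\mathbf{I}-(\mathbf{S}\mathbf{Q})^\top(\mathbf{S}\mathbf{Q})\|_2\leqslant\epsilon$ (spectral norm) holds with probability at least $1-\delta$. $\mathrm{im}(\cdot)$ denotes the column space. *)

(* Defs.v *)
From HB Require Import structures.
From mathcomp Require Import all_boot all_order all_algebra.
From mathcomp Require Import all_classical all_reals all_analysis.

Set Implicit Arguments.
Unset Strict Implicit.
Unset Printing Implicit Defensive.

Import Order.TTheory GRing.Theory Num.Theory.

Local Open Scope classical_set_scope.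
Local Open Scope ring_scope.

Section LinearAlgebra.
Context {R : realType}.

Definition l2norm n (x : 'cV[R]_n) : R := Num.sqrt (\sum_(i < n) x i 0 ^+ 2).

(* The norm MathComp-Analysis puts on matrices is the entrywise maximum, hence
   this definition. The supremum is over the closed unit ball, not the unit
   sphere, so that it is over a nonempty set also when n = 0. *)
Definition spectral_norm m n (A : 'M[R]_(m, n)) : R :=
  sup [set l2norm (A *m x) | x in [set x : 'cV[R]_n | l2norm x <= 1]].

Definition orthonormal_cols m k (Q : 'M[R]_(m, k)) : Prop := Q^T *m Q = 1%:M.

(* MathComp's row-space notations act on row vectors; the column space is the
   range of x |-> A *m x on column vectors. *)
Definition im m n (A : 'M[R]_(m, n)) : {vspace 'cV[R]_m} :=
  limg (linfun (mulmx A : 'cV[R]_n -> 'cV[R]_m)).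

Definition orthonormal_basis m k (T : {vspace 'cV[R]_m}) (Q : 'M[R]_(m, k)) :
  Prop := orthonormal_cols Q /\ im Q = T.

(* Every T has an orthonormal basis Q, and the norm below does not depend on
   which one is used. *)
Definition embeds r m (S : 'M[R]_(r, m)) (T : {vspace 'cV[R]_m}) (eps : R) :
    Prop :=
  exists (k : nat) (Q : 'M[R]_(m, k)), orthonormal_basis T Q /\
    spectral_norm (1%:M - (S *m Q)^T *m (S *m Q)) <= eps.

End LinearAlgebra.

Section RandomMatrices.
Context {disp : measure_display} {Omega : measurableType disp} {R : realType}.

Definition random_matrix m n (S : Omega -> 'M[R]_(m, n)) : Prop :=
  forall i j, measurable_fun [set: Omega] (fun w => S w i j).

(* The subspace may itself be random, as is im (Pi1 U) for a random Pi1; the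
   probability is then over the joint law of S and T. A fixed subspace is a
   constant T. *)
Definition subspace_embedding (P : probability Omega R) r m
    (S : Omega -> 'M[R]_(r, m)) (T : Omega -> {vspace 'cV[R]_m})
    (delta eps : R) : Prop :=
  ((1 - delta)%:E <= P [set w | embeds (S w) (T w) eps])%E.

End RandomMatrices.

(* Main.v *)
Require Import Defs.
From HB Require Import structures.
From mathcomp Require Import all_boot all_order all_algebra.
From mathcomp Require Import all_classical all_reals all_analysis.
From mathcomp Require Import measurable_realfun ring lra.

Set Implicit Arguments.
Unset Strict Implicit.
Unset Printing Implicit Defensive.

Import Order.TTheory GRing.Theory Num.Theory.
Import numFieldNormedType.Exports.

Local Open Scope classical_set_scope.
Local Open Scope ring_scope.

(* A matrix S embeds im V with distortion e iff
     | |Vx|^2 - |SVx|^2 | <= e |Vx|^2   for all x,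
   a condition in which no orthonormal basis occurs. Chaining it for Pi1 on
   im U and Pi2 on im (Pi1 U) gives the distortion e' (2 + e') = eps, and the
   union bound gives the probability. The value of P on a non-measurable set is
   arbitrary, so the events must be shown measurable: by continuity and density
   it suffices to impose the condition on rational x, which turns the event into
   a countable intersection, even when the subspace is random. *)

(** * Euclidean inner product on column vectors *)

Section DotProduct.
Context {R : realType}.

(** A matrix product rather than a sum, so that bilinearity and the adjoint identity are matrix
    algebra. *)
Definition dotv n (x y : 'cV[R]_n) : R := (x^T *m y) 0 0.

Lemma dotvE n (x y : 'cV[R]_n) : dotv x y = \sum_i x i 0 * y i 0.
Proof. by rewrite /dotv mxE; apply: eq_bigr => i _; rewrite mxE. Qed.

Lemma dotvC n (x y : 'cV[R]_n) : dotv x y = dotv y x.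
Proof. by rewrite !dotvE; apply: eq_bigr => i _; rewrite mulrC. Qed.

Lemma dotvDl n (x y z : 'cV[R]_n) : dotv (x + y) z = dotv x z + dotv y z.
Proof. by rewrite /dotv linearD mulmxDl mxE. Qed.

Lemma dotvDr n (x y z : 'cV[R]_n) : dotv x (y + z) = dotv x y + dotv x z.
Proof. by rewrite /dotv mulmxDr mxE. Qed.

Lemma dotvZl n a (x y : 'cV[R]_n) : dotv (a *: x) y = a * dotv x y.
Proof. by rewrite /dotv linearZ -scalemxAl mxE. Qed.

Lemma dotvZr n a (x y : 'cV[R]_n) : dotv x (a *: y) = a * dotv x y.
Proof. by rewrite /dotv -scalemxAr mxE. Qed.

Lemma dotvBr n (x y z : 'cV[R]_n) : dotv x (y - z) = dotv x y - dotv x z.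
Proof. by rewrite dotvDr -scaleN1r dotvZr mulN1r. Qed.

Lemma dotv_adjoint m n (A : 'M[R]_(m, n)) x y :
  dotv (A *m x) y = dotv x (A^T *m y).
Proof. by rewrite /dotv trmx_mul mulmxA. Qed.

Lemma dotv_ge0 n (x : 'cV[R]_n) : 0 <= dotv x x.
Proof. by rewrite dotvE; apply: sumr_ge0 => i _; rewrite -expr2 sqr_ge0. Qed.

Lemma dotv_eq0 n (x : 'cV[R]_n) : (dotv x x == 0) = (x == 0).
Proof.
apply/eqP/eqP => [|->]; last by rewrite /dotv mulmx0 mxE.
rewrite dotvE => /eqP.
rewrite psumr_eq0 => [/allP x0|i _]; last by rewrite -expr2 sqr_ge0.
apply/colP => i; rewrite mxE; apply/eqP.
by have := x0 i (mem_index_enum i); rewrite mulf_eq0 orbb.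
Qed.

Lemma l2normE n (x : 'cV[R]_n) : l2norm x = Num.sqrt (dotv x x).
Proof.
by rewrite dotvE; congr Num.sqrt; apply: eq_bigr => i _; rewrite expr2.
Qed.

Lemma l2norm_le n (x : 'cV[R]_n) c :
  0 <= c -> (l2norm x <= c) = (dotv x x <= c ^+ 2).
Proof.
move=> c0; rewrite l2normE -[LHS]ler_sqr ?nnegrE ?sqrtr_ge0 //.
by rewrite sqr_sqrtr ?dotv_ge0.
Qed.

End DotProduct.

(** * Spectral norm through quadratic inequalities *)

Section SpectralNorm.
Context {R : realType}.

(** [sup] dominates its set only if the set is bounded. On the unit ball every [|x j 0| <= 1], so
    entry i of [A *m x] is at most the absolute sum of row i. *)
Lemma l2norm_mulmx_bounded m n (A : 'M[R]_(m, n)) :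
  has_ubound [set l2norm (A *m x) | x in [set x : 'cV[R]_n | l2norm x <= 1]].
Proof.
exists (Num.sqrt (\sum_i (\sum_j `|A i j|) ^+ 2)) => _ [x /= x1 <-].
apply: ler_wsqrtr; apply: ler_sum => i _.
rewrite -[leLHS]real_normK ?num_real // lerXn2r ?nnegrE ?sumr_ge0 //.
rewrite mxE (le_trans (ler_norm_sum _ _ _))//; apply: ler_sum => j _.
rewrite normrM ler_piMr//.
move: x1; rewrite l2norm_le // expr1n dotvE (bigD1 j)//= => x1.
have : x j 0 * x j 0 <= 1.
  apply: le_trans x1; rewrite lerDl sumr_ge0 // => k _.
  by rewrite -expr2 sqr_ge0.
by rewrite -expr2 -real_normK ?num_real // expr_le1.
Qed.

Lemma spectral_norm_leP m n (A : 'M[R]_(m, n)) (e : R) : 0 <= e ->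
  spectral_norm A <= e <->
  forall x, dotv (A *m x) (A *m x) <= e ^+ 2 * dotv x x.
Proof.
move=> e0; split=> [Ae x|Ae].
  have [->|x0] := eqVneq x 0; first by rewrite mulmx0 /dotv !mulmx0 !mxE mulr0.
  have xx0 : 0 < dotv x x by rewrite lt_neqAle eq_sym dotv_eq0 x0 dotv_ge0.
  have c0 : 0 < l2norm x by rewrite l2normE sqrtr_gt0.
  have cE : l2norm x ^+ 2 = dotv x x by rewrite l2normE sqr_sqrtr// ltW.
  pose y := (l2norm x)^-1 *: x.
  (* Used with [B] the identity for the norm of [y], and with [B = A] for the bound. *)
  have Ey k (B : 'M[R]_(k, n)) :
      dotv (B *m y) (B *m y) = dotv (B *m x) (B *m x) / dotv x x.
    by rewrite -scalemxAr dotvZl dotvZr -cE; field; rewrite gt_eqF.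
  have y1 : l2norm y <= 1.
    by rewrite l2norm_le // expr1n -[y]mul1mx Ey mul1mx divff // gt_eqF.
  have : l2norm (A *m y) <= e.
    apply: le_trans Ae; apply: ub_le_sup; last by exists y.
    exact: l2norm_mulmx_bounded.
  by rewrite l2norm_le // Ey ler_pdivrMr.
apply: ge_sup => [|_ [x /= x1 <-]].
  exists (l2norm (A *m 0)), 0 => //=.
  by rewrite l2norm_le // /dotv mulmx0 mxE expr1n.
rewrite l2norm_le // (le_trans (Ae x))// ler_piMr ?sqr_ge0//.
by rewrite l2norm_le // expr1n in x1.
Qed.

(** The norm of a symmetric matrix is the largest absolute value of its quadratic form on the unit
    ball; the proof avoids eigenvalues. *)
Lemma spectral_norm_symP n (M : 'M[R]_n) (e : R) : 0 < e -> M^T = M ->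
  spectral_norm M <= e <-> forall x, `|dotv x (M *m x)| <= e * dotv x x.
Proof.
move=> e0 Msym; rewrite spectral_norm_leP ?ltW//; split=> Me x.
  (* Expand the squared norm of [c *: x + M *m x]; with c = e and c = -e, the bound on [M *m x]
     leaves the two sides of the claim multiplied by e. *)
  have sq c : 0 <= c ^+ 2 * dotv x x + 2 * c * dotv x (M *m x)
                   + dotv (M *m x) (M *m x).
    have := dotv_ge0 (c *: x + M *m x).
    by rewrite !(dotvDl, dotvDr, dotvZl, dotvZr) (dotvC (M *m x) x); nra.
  have := sq e; have := sq (- e); have := Me x.
  rewrite ler_norml; move: (dotv _ _) (dotv _ _) (dotv _ _) => a b c *.
  have ? : - (e * b) <= a by rewrite -(ler_pM2l e0); lra.
  have ? : a <= e * b by rewrite -(ler_pM2l e0); lra.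
  by apply/andP.
(* Polarization: subtract the bounds at x + M x / e and x - M x / e. *)
have adj u v : dotv (M *m u) v = dotv u (M *m v) by rewrite dotv_adjoint Msym.
pose a := dotv x x; pose q := dotv x (M *m x); pose b := dotv x (M *m (M *m x)).
pose s := dotv x (M *m (M *m (M *m x))).
have Mxt t : `|q + 2 * t * b + t ^+ 2 * s| <= e * (a + 2 * t * q + t ^+ 2 * b).
  have := Me (x + t *: (M *m x)); congr (`| _ | <= e * _).
    rewrite mulmxDr -!scalemxAr !(dotvDl, dotvDr, dotvZl, dotvZr) !adj.
    by rewrite -/q -/b -/s; ring.
  by rewrite !(dotvDl, dotvDr, dotvZl, dotvZr) !adj -/a -/q -/b; ring.
have /ler_normlP[_ le1] := Mxt e^-1.
have /ler_normlP[le2 _] := Mxt (- e^-1).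
rewrite adj -/b -/a.
have eV : e * (e^-1 ^+ 2 * b) = e^-1 * b by field; rewrite gt_eqF.
(* Adding the two bounds cancels [q] and [s], leaving 4 b / e <= 2 e a + 2 b / e. *)
have : e^-1 * b <= e * a by move: (e^-1) le1 le2 eV => t *; lra.
by rewrite ler_pdivrMl // mulrA -expr2.
Qed.

End SpectralNorm.

(** * Embedding property without a basis *)

Section Embedding.
Context {R : realType}.

Lemma memv_im m n (A : 'M[R]_(m, n)) y :
  reflect (exists x, y = A *m x) (y \in im A).
Proof.
by apply: (iffP memv_imgP) => [[x _]|[x]] ->; exists x; rewrite ?lfunE ?memvf.
Qed.

Lemma im_mulmx_sub m n k (A : 'M[R]_(m, n)) (B : 'M[R]_(n, k)) :
  (im (A *m B) <= im A)%VS.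
Proof.
apply/subvP => _ /memv_im[x ->]; apply/memv_im; exists (B *m x).
by rewrite mulmxA.
Qed.

(** Induction on columns: the first column is orthogonalized against a basis for the others. The two
    factorizations encode equality of column spaces; [k] is existential because [V] may be rank
    deficient. *)
Lemma gram_schmidt m n (V : 'M[R]_(m, n)) : exists k (Q : 'M[R]_(m, k)),
  orthonormal_cols Q /\
  exists (A : 'M[R]_(n, k)) (B : 'M[R]_(k, n)), Q = V *m A /\ V = Q *m B.
Proof.
elim: n V => [|n IHn] V.
  exists 0%N, 0; split; first by apply/matrixP => -[].
  by exists 0, 0; split; apply/matrixP => ? -[].
rewrite -[n.+1]/(1 + n)%N in V *; rewrite -[V]hsubmxK.
set v := lsubmx V; set W := rsubmx V.
have [k [Q [QQ [A [B [QA WB]]]]]] := IHn W.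
pose c := Q^T *m v; pose u := v - Q *m c.
have Qu : Q^T *m u = 0 by rewrite mulmxBr mulmxA QQ mul1mx subrr.
(* If the residual vanishes, [v = Q *m c] adds no basis vector; otherwise [u] is normalized and
   prepended. *)
have [u0|u0] := eqVneq u 0.
  exists k, Q; split=> //; exists (col_mx 0 A), (row_mx c B).
  rewrite mul_row_col mulmx0 add0r mul_mx_row -WB; split=> //.
  by move/eqP: u0; rewrite subr_eq0 => /eqP <-.
pose a := l2norm u.
have uu : u^T *m u = (a ^+ 2)%:M.
  by rewrite [LHS]mx11_scalar /a l2normE sqr_sqrtr ?dotv_ge0.
have a0 : a != 0.
  by rewrite /a l2normE sqrtr_eq0 -ltNge lt_neqAle eq_sym dotv_eq0 u0 dotv_ge0.
exists (1 + k)%N, (row_mx (a^-1 *: u) Q); split.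
  rewrite /orthonormal_cols tr_row_mx mul_col_row.
  have -> : (a^-1 *: u)^T = a^-1 *: u^T by apply/matrixP => i j; rewrite !mxE.
  rewrite -!scalemxAl -scalemxAr uu -scalemxAr Qu QQ.
  have -> : u^T *m Q = 0 by rewrite -[Q]trmxK -trmx_mul Qu trmx0.
  rewrite !scaler0 scalerA scale_scalar_mx -invfM -expr2 mulVf ?expf_neq0 //.
  by rewrite -scalar_mx_block.
(* The coefficients come from u / a = v / a - W A c / a, using Q = W A, and from v = a (u / a) + Q
   c. *)
exists (block_mx a^-1%:M 0 (- (a^-1 *: (A *m c))) A), (block_mx a%:M 0 c B).
rewrite !mul_row_block !mulmx0 !add0r -QA -WB; split; congr row_mx.
  by rewrite mul_mx_scalar mulmxN -scalemxAr mulmxA -QA -scalerBr.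
by rewrite mul_mx_scalar scalerA divff // scale1r subrK.
Qed.

(** For y = Q z, |z| = |y| and the quadratic form of I - (SQ)^T (SQ) at z is |y|^2 - |Sy|^2, so [Q]
    matters only through its column space. [V] is arbitrary, which allows [Pi1 w *m U]. *)
Lemma embedsP r m n (S : 'M[R]_(r, m)) (V : 'M[R]_(m, n)) (e : R) : 0 < e ->
  embeds S (im V) e <->
  forall x, `|dotv (V *m x) (V *m x) - dotv (S *m (V *m x)) (S *m (V *m x))|
            <= e * dotv (V *m x) (V *m x).
Proof.
move=> e0.
have normE k (Q : 'M[R]_(m, k)) : orthonormal_cols Q ->
    spectral_norm (1%:M - (S *m Q)^T *m (S *m Q)) <= e <->
    forall y, y \in im Q ->
      `|dotv y y - dotv (S *m y) (S *m y)| <= e * dotv y y.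
  move=> QQ; rewrite spectral_norm_symP //; last first.
    by rewrite linearB /= trmx1 trmx_mul trmxK.
  have D z : dotv (Q *m z) (Q *m z) = dotv z z.
    by rewrite dotv_adjoint mulmxA QQ mul1mx.
  have E z : dotv z ((1%:M - (S *m Q)^T *m (S *m Q)) *m z) =
      dotv (Q *m z) (Q *m z) - dotv (S *m (Q *m z)) (S *m (Q *m z)).
    by rewrite mulmxBl dotvBr mul1mx -mulmxA -dotv_adjoint -!mulmxA D.
  split=> [H _ /memv_im[z ->]|H z]; first by rewrite -E D.
  by rewrite E -D; apply: H; apply/memv_im; exists z.
split=> [[k [Q [[QQ imQ] /(normE _ _ QQ) H]]] x|H].
  by apply: H; rewrite imQ; apply/memv_im; exists x.
have [k [Q [QQ [A [B [QA VB]]]]]] := gram_schmidt V.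
exists k, Q; split.
  split=> //; apply/eqP; rewrite eqEsubv [in X in X && _]QA im_mulmx_sub.
  by rewrite [in X in (X <= _)%VS]VB im_mulmx_sub.
by apply/normE => // _ /memv_im[z ->]; rewrite QA -mulmxA.
Qed.

End Embedding.

(** * Reduction to rational vectors *)

Section RationalVectors.
Context {R : realType}.

(** A neighbourhood of a matrix contains a product of neighbourhoods of its entries; pick a rational
    in each. *)
Lemma dense_ratr_mx m n :
  dense (range (map_mx ratr : 'M[rat]_(m, n) -> 'M[R]_(m, n))).
Proof.
move=> O [x Ox]; rewrite openE => /(_ _ Ox)[P xP PO].
have [q qP] : {q : 'I_m -> 'I_n -> rat | forall i j, P i j (ratr (q i j))}.
  suff H i j : {q : rat | P i j (ratr q)}.
    by exists (fun i j => sval (H i j)) => i j; exact: (svalP (H i j)).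
  apply: cid; have [||y [Py [q _ qy]]] := @dense_rat R (P i j)^°.
  - by exists (x i j); exact: xP.
  - exact: open_interior.
  by exists q; rewrite qy; exact: interior_subset.
exists (map_mx ratr (\matrix_(i, j) q i j)); split; last first.
  by exists (\matrix_(i, j) q i j).
by apply: PO => i j; rewrite !mxE.
Qed.

Lemma continuous_dotv_mulmx m n (A : 'M[R]_(m, n)) :
  continuous (fun x : 'cV[R]_n => dotv (A *m x) (A *m x)).
Proof.
under eq_fun do rewrite dotvE.
apply: continuous_big => [|i _]; first exact: add_continuous.
suff c : continuous (fun x : 'cV[R]_n => (A *m x) i 0).
  by move=> x; exact: (continuousM (c x) (c x)).
under eq_fun do rewrite mxE.
apply: continuous_big => [|j _]; first exact: add_continuous.
move=> x; exact: (continuousM (@cst_continuous _ _ (A i j) x)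
                              (@coord_continuous R n 1 j 0 x)).
Qed.

Lemma embeds_ratP r m n (S : 'M[R]_(r, m)) (V : 'M[R]_(m, n)) (e : R) :
  0 < e ->
  embeds S (im V) e <->
  forall q : 'cV[rat]_n, let x : 'cV[R]_n := map_mx ratr q in
    `|dotv (V *m x) (V *m x) - dotv ((S *m V) *m x) ((S *m V) *m x)|
      <= e * dotv (V *m x) (V *m x).
Proof.
move=> e0; rewrite embedsP //; split=> [H q /=|H x]; first by rewrite -mulmxA.
pose f (x : 'cV[R]_n) := e * dotv (V *m x) (V *m x) -
  `|dotv (V *m x) (V *m x) - dotv ((S *m V) *m x) ((S *m V) *m x)|.
have cf : continuous f.
  have cV := @continuous_dotv_mulmx _ _ V.
  have cSV := @continuous_dotv_mulmx _ _ (S *m V).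
  move=> y; have cN := @cvg_norm _ _ _ _ _ _ _ (continuousB (cV y) (cSV y)).
  have cf := cvgB (continuousM (@cst_continuous _ _ e y) (cV y)) (cN _).
  exact: cf.
(* A failure at [x] means [f x < 0], an open condition, which would then hold at some rational
   vector. *)
rewrite mulmxA -subr_ge0 -/(f x) leNgt; apply/negP => fx.
have [||y [/= fy [q _ qy]]] := @dense_ratr_mx n 1 [set y | f y < 0].
- by exists x.
- by move/continuousP: cf => /(_ [set t | t < 0]); apply; exact: open_lt.
by move: fy; rewrite -qy ltNge subr_ge0 => /negP; apply; exact: H.
Qed.

End RationalVectors.

(** * Measurability of the events and the union bound *)

Section Measurability.
Context {disp : measure_display} {Omega : measurableType disp} {R : realType}.

Lemma random_matrix_cst m n (A : 'M[R]_(m, n)) :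
  random_matrix (fun _ : Omega => A).
Proof. by move=> i j; exact: measurable_cst. Qed.

Lemma random_matrix_mul m n p (A : Omega -> 'M[R]_(m, n))
    (B : Omega -> 'M[R]_(n, p)) :
  random_matrix A -> random_matrix B -> random_matrix (fun w => A w *m B w).
Proof.
move=> mA mB i j; under eq_fun do rewrite mxE.
by apply: measurable_sum => k; exact: measurable_funM.
Qed.

Lemma measurable_dotv n (x y : Omega -> 'cV[R]_n) :
  random_matrix x -> random_matrix y ->
  measurable_fun setT (fun w => dotv (x w) (y w)).
Proof.
move=> mx my; under eq_fun do rewrite dotvE.
by apply: measurable_sum => k; exact: measurable_funM.
Qed.

(** The random subspace enters through a random spanning matrix [V], so everything reduces to
    measurable entries. *)
Lemma measurable_embeds r m n (S : Omega -> 'M[R]_(r, m))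
    (V : Omega -> 'M[R]_(m, n)) (e : R) : 0 < e ->
  random_matrix S -> random_matrix V ->
  measurable [set w | embeds (S w) (im (V w)) e].
Proof.
move=> e0 mS mV.
pose x (q : 'cV[rat]_n) : 'cV[R]_n := map_mx ratr q.
pose E q := [set w |
  `|dotv (V w *m x q) (V w *m x q)
    - dotv ((S w *m V w) *m x q) ((S w *m V w) *m x q)|
    <= e * dotv (V w *m x q) (V w *m x q)].
have mVx q : random_matrix (fun w => V w *m x q).
  exact: (random_matrix_mul mV (random_matrix_cst _)).
have mSVx q : random_matrix (fun w => (S w *m V w) *m x q).
  exact: (random_matrix_mul (random_matrix_mul mS mV) (random_matrix_cst _)).
have mE q : measurable (E q).
  rewrite -[E q]setTI; apply: measurable_fun_le => //.
    by apply: measurableT_comp => //; apply: measurable_funB;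
      apply: measurable_dotv.
  by apply: measurable_funM => //; exact: measurable_dotv.
(* Rational vectors are indexed by their codes in nat; a number coding no vector contributes the
   whole space. *)
have -> : [set w | embeds (S w) (im (V w)) e] =
    \bigcap_k (if unpickle k is Some q then E q else setT).
  apply/seteqP; split=> w /=.
    by move/(embeds_ratP _ _ e0) => H k _; case: unpickle => // q; exact: H.
  move=> H; apply/(embeds_ratP _ _ e0) => q /=.
  by have := H (pickle q) I; rewrite pickleK.
by apply: bigcapT_measurable => k; case: unpickle.
Qed.

(** Union bound on the complements, valid for dependent events. *)
Lemma probability_setI_ge (P : probability Omega R) (A B : set Omega) a b :
  measurable A -> measurable B ->
  ((1 - a)%:E <= P A)%E -> ((1 - b)%:E <= P B)%E ->
  ((1 - (a + b))%:E <= P (A `&` B))%E.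
Proof.
move=> mA mB.
have : (P (~` (A `&` B)) <= P (~` A) + P (~` B))%E.
  by rewrite setCI; apply: measureU2; exact: measurableC.
rewrite !probability_setC //; last exact: measurableI.
have fin C : measurable C -> P C = (fine (P C))%:E.
  by move=> mC; rewrite fineK // fin_num_measure.
rewrite (fin _ mA) (fin _ mB) (fin _ (measurableI _ _ mA mB)).
by rewrite -!EFinB -EFinD !lee_fin; lra.
Qed.

End Measurability.

(** * Chaining the two sketches *)

Theorem proposition4 (R : realType) (disp : measure_display)
    (Omega : measurableType disp) (P : probability Omega R)
    (N d r r' : nat) (eps delta : R)
    (heps : 0 < eps < 1) (hdelta : 0 < delta < 1)
    (U : 'M[R]_(N, d)) (hU : orthonormal_cols U)
    (Pi1 : Omega -> 'M[R]_(r, N)) (Pi2 : Omega -> 'M[R]_(r', r))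
    (hPi1 : random_matrix Pi1) (hPi2 : random_matrix Pi2) :
  let delta' := delta / 2 in
  let eps' := Num.sqrt (1 + eps) - 1 in
  subspace_embedding P Pi1 (fun=> im U) delta' eps' ->
  subspace_embedding P Pi2 (fun w => im (Pi1 w *m U)) delta' eps' ->
  subspace_embedding P (fun w => Pi2 w *m Pi1 w) (fun=> im U) delta eps.
Proof.
case/andP: heps => eps0 _ delta' eps' P1 P2.
have eps'0 : 0 < eps' by rewrite subr_gt0 -{1}sqrtr1 ltr_sqrt; lra.
(* The choice of [eps'] makes (1 + eps')^2 = 1 + eps, so the chained distortion is exactly [eps]. *)
have eps'E : eps' * (2 + eps') = eps.
  have : (1 + eps') ^+ 2 = 1 + eps by rewrite subrKC sqr_sqrtr; lra.
  lra.
have mU := @random_matrix_cst _ Omega _ _ _ U.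
have mPi1U := random_matrix_mul hPi1 mU.
have mPi21 := random_matrix_mul hPi2 hPi1.
have m1 := measurable_embeds eps'0 hPi1 mU.
have m2 := measurable_embeds eps'0 hPi2 mPi1U.
(* Each sketch uses up one half of [delta]. *)
rewrite /subspace_embedding [delta]splitr.
apply: le_trans (probability_setI_ge m1 m2 P1 P2) _.
apply: le_measure; rewrite ?inE; [exact: measurableI|exact: measurable_embeds|].
move=> w [/= /(embedsP _ _ eps'0) H1 /(embedsP _ _ eps'0) H2].
apply/embedsP => // x.
have := H1 x; have := H2 x; rewrite -!mulmxA.
(* Here |a - b| <= eps' a and |b - c| <= eps' b. Since b <= (1 + eps') a, it follows that |a - c| <=
   eps' (2 + eps') a. *)
move: (dotv (U *m x) _) (dotv (Pi1 w *m _) _) (dotv (Pi2 w *m _) _) => a b c.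
rewrite -eps'E !ler_norml => /andP[h1 h2] /andP[h3 h4].
have : eps' * b <= eps' * (a + eps' * a) by rewrite ler_pM2l //; lra.
by move=> h5; apply/andP; split; lra.
Qed.
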